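(* Let $E$ be a finite nonempty set, let $u_1:2^E\to\mathbb{R}$ be an ordinally w-concave function satisfying the unique-maximizer condition (for every $X\subseteq E$ the problem $\max\{u_1(Y)\mid Y\subseteq X\}$ has a unique maximizer), and let $u_2:2^E\to\mathbb{R}$ be ordinally w-concave. Then the lexicographic composition $\hat u=u_1\diamond u_2$ is ordinally w-concave, i.e., for every $X,Y\in 2^E$ with $X\neq Y$ there exist distinct $x\in(X\setminus Y)\cup\{\emptyset\}$ and $y\in(Y\setminus X)\cup\{\emptyset\}$ such that $\hat u(X)<_\ell\hat u(X-x+y)$, or $\hat u(Y)<_\ell\hat u(Y-y+x)$, or ($\hat u(X)=\hat u(X-x+y)$ and $\hat u(Y)=\hat u(Y-y+x)$).
   Context: Notation: for $X\subseteq E$ and $x\in E\setminus X$, $X+x=X\cup\{x\}$; for $x\in X$, $X-x=X\setminus\{x\}$. The symbol $\emptyset$ is also used as a formal element not in $E$, with $X+\emptyset=X-\emptyset=X$. A function $u:2^E\to\mathbb{R}$ is ordinally w-concave if for every $X,X'\in 2^E$ with $X\neq X'$ there exist distinct $x\in(X\setminus X')\cup\{\emptyset\}$ and $x'\in(X'\setminus X)\cup\{\emptyset\}$ such that (i) $u(X)<u(X-x+x')$, or (ii) $u(X')<u(X'-x'+x)$, or (iii) $u(X)=u(X-x+x')$ and $u(X')=u(X'-x'+x)$. The lexicographic order on $\mathbb{R}^2$: $(a,b)<_\ell(c,d)$ iff $a<c$, or $a=c$ and $b<d$. The lexicographic composition $\hat u=u_1\diamond u_2:2^E\to\mathbb{R}^2$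 is defined by letting $\hat u(X)$ be the lexicographic maximum of $(u_1(X_1),u_2(X\setminus X_1))$ over all $X_1\subseteq X$ (with respect to $\le_\ell$). *)

(* Defs.v *)
From mathcomp Require Import all_boot all_order all_algebra.
From mathcomp Require Import reals.

Set Implicit Arguments.
Unset Strict Implicit.
Unset Printing Implicit Defensive.

Import Order.TTheory.

(* The formal element "emptyset" is [None : option E], so that
   X + emptyset = X - emptyset = X. *)
Definition addo (E : finType) (X : {set E}) (x : option E) : {set E} :=
  if x is Some a then a |: X else X.

Definition delo (E : finType) (X : {set E}) (x : option E) : {set E} :=
  if x is Some a then X :\ a else X.

(* x \in A \cup {emptyset} *)
Definition in_opt (E : finType) (A : {set E}) (x : option E) : Prop :=
  if x is Some a then a \in A else True.

(* Stated over an arbitrary totally ordered codomain, so that the same notion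
   applies to real-valued functions and to functions into [R *l R]. *)
Definition ordinally_w_concave (d : Order.disp_t) (T : orderType d)
    (E : finType) (u : {set E} -> T) : Prop :=
  forall X Y : {set E}, X <> Y ->
    exists x y : option E,
      [/\ in_opt (X :\: Y) x, in_opt (Y :\: X) y, x <> y &
          [\/ (u X < u (addo (delo X x) y))%O,
              (u Y < u (addo (delo Y y) x))%O |
              u X = u (addo (delo X x) y) /\ u Y = u (addo (delo Y y) x)]].

Definition unique_maximizer (d : Order.disp_t) (T : orderType d)
    (E : finType) (u : {set E} -> T) : Prop :=
  forall X : {set E}, exists! Y : {set E},
    Y \subset X /\ forall Z : {set E}, Z \subset X -> (u Z <= u Y)%O.

(* [R *l R] is R * R with the lexicographic order, see [lt_lexE]. *)
Definition lex_pair (R : realType) (E : finType) (u1 u2 : {set E} -> R)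
    (X X1 : {set E}) : R *l R := (u1 X1, u2 (X :\: X1)).

(* The default index of the iterated maximum is the value at X1 = set0, which
   is itself in the range, so it does not affect the result. *)
Definition lex_comp (R : realType) (E : finType) (u1 u2 : {set E} -> R)
    (X : {set E}) : R *l R :=
  \big[Order.max/lex_pair u1 u2 X set0]_(X1 : {set E} | X1 \subset X)
    lex_pair u1 u2 X X1.

Lemma lt_lexE (R : realType) (p q : R *l R) :
  (p < q)%O <-> (p.1 < q.1)%R \/ p.1 = q.1 /\ (p.2 < q.2)%R.
Proof.
case: p q => [a b] [c e]; rewrite ltEprodlexi /=.
case: (ltgtP a c) => [ac|ca|->] /=.
- by split=> // _; left.
- by split=> // -[//|[eac]]; move: ca; rewrite eac ltxx.
- by split=> [be|[//|[]//]]; right.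
Qed.

Lemma lex_comp_ge (R : realType) (E : finType) (u1 u2 : {set E} -> R)
    (X X1 : {set E}) :
  X1 \subset X -> (lex_pair u1 u2 X X1 <= lex_comp u1 u2 X)%O.
Proof. by move=> sX1X; apply: (le_bigmax_cond _ (lex_pair u1 u2 X)). Qed.

Lemma lex_comp_attained (R : realType) (E : finType) (u1 u2 : {set E} -> R)
    (X : {set E}) :
  exists2 X1 : {set E}, X1 \subset X & lex_comp u1 u2 X = lex_pair u1 u2 X X1.
Proof.
rewrite /lex_comp; elim/big_ind: _ => [|a b [A sA ->] [B sB ->]|A sA].
- by exists set0; rewrite ?sub0set.
- case: (leP (lex_pair u1 u2 X A) (lex_pair u1 u2 X B)) => _.
    by exists B.
  by exists A.
- by exists A.
Qed.

(* Main.v *)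
Require Import Defs.
From mathcomp Require Import all_boot all_order all_algebra.
From mathcomp Require Import reals.

Set Implicit Arguments.
Unset Strict Implicit.
Unset Printing Implicit Defensive.

Import Order.TTheory.

(** Write [C(X)] for the unique maximizer of [u1] over the subsets of [X], so
    that the composition takes the value [(u1 (C(X)), u2 (X :\: C(X)))].  If
    adding a single element of [Y :\: X] to [X] (or of [X :\: Y] to [Y])
    increases the maximum of [u1], the first coordinate strictly increases.
    Otherwise w-concavity of [u1] forces [C(X) = C(X :|: Y) = C(Y) =: A].  Then
    [A] is also the maximizer for every set between [A] and [X :|: Y], and the
    exchange given by [u2] for [X :\: A] and [Y :\: A] works for [X] and [Y]. *)

(** Uniqueness is stated as strict domination, so that any competitor loses strictly in the first
    lexicographic coordinate. *)
Definition strict_argmax (d : Order.disp_t) (T : orderType d) (E : finType)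
    (u : {set E} -> T) (X A : {set E}) : Prop :=
  A \subset X /\
  forall Z : {set E}, Z \subset X -> Z <> A -> (u Z < u A)%O.

Section StrictArgmax.
Variables (d : Order.disp_t) (T : orderType d) (E : finType).
Implicit Types (u : {set E} -> T) (X Y Z W A D : {set E}).

Lemma unique_maximizer_strict_argmax u X :
  unique_maximizer u -> exists A, strict_argmax u X A.
Proof.
move=> /(_ X) [A [[sAX maxA] uniqA]]; exists A; split=> // Z sZX neZA.
rewrite lt_neqAle maxA // andbT; apply/eqP => eqZA; apply: neZA.
by apply/esym/uniqA; split=> // V /maxA; rewrite eqZA.
Qed.

Lemma strict_argmax_le u X A Z :
  strict_argmax u X A -> Z \subset X -> (u Z <= u A)%O.
Proof.
by move=> [_ maxA] sZX; have [->//|/eqP neZA] := eqVneq Z A; apply/ltW/maxA.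
Qed.

Lemma strict_argmax_between u X A W :
  strict_argmax u X A -> A \subset W -> W \subset X -> strict_argmax u W A.
Proof.
by move=> [_ maxA] sAW sWX; split=> // Z sZW; apply/maxA/(subset_trans sZW).
Qed.

Lemma addo_delo_sub A X (x y : option E) :
  A \subset X -> in_opt X y -> addo (delo A x) y \subset X.
Proof.
move=> sAX Xy.
have sdX : delo A x \subset X.
  by case: x => [a|//] /=; apply: subset_trans (subD1set _ _) sAX.
by case: y Xy => [b|//] /= Xb; rewrite subUset sub1set Xb.
Qed.

Lemma addo_delo_neq X Y (x y : option E) :
  in_opt (X :\: Y) x -> in_opt (Y :\: X) y -> x <> y ->
  addo (delo X x) y <> X.
Proof.
case: x y => [a|] [b|] //=.
- move=> /setDP[Xa Ya] /setDP[Yb Xb] _ eqX.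
  by move: Xb; rewrite -eqX setU11.
- by move=> /setDP[Xa Ya] _ _ eqX; move: Xa; rewrite -eqX setD11.
- by move=> _ /setDP[Yb Xb] _ eqX; move: Xb; rewrite -eqX setU11.
Qed.

(* A maximizer that no single added element improves stays the maximizer when
   all of them are added: this is where w-concavity yields substitutability. *)
Lemma strict_argmax_extend u X W A D :
  ordinally_w_concave u -> X \subset W ->
  strict_argmax u X A -> strict_argmax u W D ->
  (forall y Z, y \in W :\: X -> Z \subset y |: X -> (u Z <= u A)%O) ->
  D = A.
Proof.
move=> cu sXW hA hD noimp; apply/eqP/negPn/negP => /eqP neDA.
have [sAX _] := hA; have [sDW maxD] := hD.
have [x [y [Ax Dy nexy alt]]] := cu A D (nesym neDA).
(* The exchanged set stays inside [W] and differs from [D], so strictness of the maximum at [D]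
   rules out alternatives (ii) and (iii). *)
have Dlt : (u (addo (delo D y) x) < u D)%O.
  apply: maxD (addo_delo_neq Dy Ax (nesym nexy)).
  apply: addo_delo_sub => //; case: x Ax {nexy alt} => [a|//] /= /setDP[Aa _].
  exact/(subsetP sXW)/(subsetP sAX).
(* At most one element outside [X] enters, so either maximality of [A] in [X] or [noimp] applies;
   this rules out (i). *)
have Ale : (u (addo (delo A x) y) <= u A)%O.
  case: y Dy {nexy alt Dlt} => [b|] /= => [/setDP[Db _]|_]; last first.
    by apply: (strict_argmax_le hA); apply: (@addo_delo_sub A X x None).
  have [Xb|nXb] := boolP (b \in X).
    by apply: (strict_argmax_le hA); apply: (@addo_delo_sub A X x (Some b)).
  apply: (noimp b); first by rewrite inE nXb (subsetP sDW).
  by apply: setUS; apply: (@addo_delo_sub A X x None).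
case: alt => [Alt|DltD|[_ eqD]].
- by have := lt_le_trans Alt Ale; rewrite ltxx.
- by have := lt_trans DltD Dlt; rewrite ltxx.
- by move: Dlt; rewrite -eqD ltxx.
Qed.

End StrictArgmax.

Section LexComp.
Variables (R : realType) (E : finType) (u1 u2 : {set E} -> R).
Implicit Types X Y A B : {set E}.

Lemma lex_comp_strict_argmax X A :
  strict_argmax u1 X A -> lex_comp u1 u2 X = lex_pair u1 u2 X A.
Proof.
move=> [sAX maxA]; have [B sBX eqB] := lex_comp_attained u1 u2 X.
have [<-//|/eqP /(maxA _ sBX) ltBA] := eqVneq B A.
have := lex_comp_ge u1 u2 sAX; rewrite eqB leNgt => /negP[].
by apply/lt_lexE; left.
Qed.

(** The set [B] need not be a maximizer: its pair already bounds the value at [Y] from below, and it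
    beats the value at [X] in the first coordinate. *)
Lemma lex_comp_lt X Y A B :
  strict_argmax u1 X A -> B \subset Y -> (u1 A < u1 B)%O ->
  (lex_comp u1 u2 X < lex_comp u1 u2 Y)%O.
Proof.
move=> hA sBY ltAB; rewrite (lex_comp_strict_argmax hA).
apply: lt_le_trans (lex_comp_ge u1 u2 sBY).
by apply/lt_lexE; left.
Qed.

End LexComp.

(** An added element lies outside [X], hence outside [A], so removing [A] does not discard it. *)
Lemma addo_delo_setD (E : finType) (X Y A : {set E}) (x y : option E) :
  A \subset X -> in_opt (Y :\: X) y ->
  addo (delo X x) y :\: A = addo (delo (X :\: A) x) y.
Proof.
move=> /subsetP sAX Xy.
have -> : delo (X :\: A) x = delo X x :\: A.
  by case: x => [a|//] /=; apply/setP => z; rewrite !inE andbCA.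
case: y Xy => [b|//] /= /setDP[_ nXb]; rewrite setDUl; congr (_ :|: _).
apply/setP => z; rewrite !inE andbC; case: eqP => // ->.
by apply: contraNN nXb => /sAX.
Qed.

Theorem theorem4p5 (R : realType) (E : finType) (hE : 0 < #|E|)
    (u1 u2 : {set E} -> R)
    (hu1 : ordinally_w_concave u1)
    (hmax1 : unique_maximizer u1)
    (hu2 : ordinally_w_concave u2) :
  ordinally_w_concave (lex_comp u1 u2).
Proof.
move=> X Y neXY.
have [A hA] := unique_maximizer_strict_argmax X hmax1.
have [B hB] := unique_maximizer_strict_argmax Y hmax1.
have [D hD] := unique_maximizer_strict_argmax (X :|: Y) hmax1.
have [/existsP[y /existsP[Z /and3P[Yy sZ ltZ]]]|noX] := boolP [exists y : E,
  exists Z : {set E}, [&& y \in Y :\: X, Z \subset y |: X & (u1 A < u1 Z)%O]].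
  exists None, (Some y); split=> //; apply: Or31.
  exact: lex_comp_lt hA sZ ltZ.
have [/existsP[x /existsP[Z /and3P[Xx sZ ltZ]]]|noY] := boolP [exists x : E,
  exists Z : {set E}, [&& x \in X :\: Y, Z \subset x |: Y & (u1 B < u1 Z)%O]].
  exists (Some x), None; split=> //; apply: Or32.
  exact: lex_comp_lt hB sZ ltZ.
have eqDA : D = A.
  apply: strict_argmax_extend hu1 (subsetUl X Y) hA hD _ => y Z.
  rewrite setDUl setDv set0U => Yy sZ; rewrite leNgt; apply: contraNN noX => ltZ.
  by apply/existsP; exists y; apply/existsP; exists Z; apply/and3P.
have eqDB : D = B.
  apply: strict_argmax_extend hu1 (subsetUr X Y) hB hD _ => x Z.
  rewrite setDUl setDv setU0 => Xx sZ; rewrite leNgt; apply: contraNN noY => ltZ.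
  by apply/existsP; exists x; apply/existsP; exists Z; apply/and3P.
move: hA hB; rewrite -eqDA -eqDB => hA hB {A B noX noY eqDA eqDB}.
have [[sDX _] [sDY _]] := (hA, hB).
(* Both sets contain [D], so each is recovered from its difference with [D]. *)
have neXYD : X :\: D <> Y :\: D.
  move=> eqXY; apply: neXY.
  by rewrite -(setID X D) -(setID Y D) eqXY (setIidPr sDX) (setIidPr sDY).
have setDD (V W : {set E}) : D \subset W -> (V :\: D) :\: (W :\: D) = V :\: W.
  move=> /subsetP sDW; apply/setP => z; rewrite !inE.
  by have [/sDW->|] := boolP (z \in D); rewrite ?andbF.
have [x [y [Xx Yy nexy alt]]] := hu2 _ _ neXYD.
move: Xx Yy; rewrite !setDD // => Xx Yy.
(* Stated for [V] and [W] to serve both directions of the exchange. The first coordinate stays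
   [u1 D], leaving only [u2] to compare. *)
have exch (V W : {set E}) v w : D \subset V -> D \subset W -> V :|: W = X :|: Y ->
    in_opt (V :\: W) v -> in_opt (W :\: V) w ->
  lex_comp u1 u2 (addo (delo V v) w) = (u1 D, u2 (addo (delo (V :\: D) v) w)).
  move=> sDV sDW eqVW Vv Ww.
  rewrite -(@addo_delo_setD _ V W) //; apply: lex_comp_strict_argmax.
  apply: strict_argmax_between hD _ _.
    (* The deleted element is outside [W], which contains [D]. *)
    have sDd : D \subset delo V v.
      case: v Vv => [a|//] /= /setDP[_ nWa]; rewrite subsetD1 sDV.
      by apply: contraNN nWa; apply/subsetP.
    by case: w {Ww} => [b|//] /=; apply/(subset_trans sDd)/subsetUr.
  rewrite -eqVW; apply: addo_delo_sub; first exact: subsetUl.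
  by case: w Ww => [b|//] /= /setDP[Wb _]; rewrite inE Wb orbT.
exists x, y; split=> //.
rewrite (exch X Y) // (exch Y X) //; last by rewrite setUC.
rewrite (lex_comp_strict_argmax _ hA).
rewrite (lex_comp_strict_argmax _ hB) /lex_pair.
case: alt => [lt2|lt2|[-> ->]]; [apply: Or31|apply: Or32|exact: Or33].
  by apply/lt_lexE; right.
by apply/lt_lexE; right.
Qed.
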